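(* There exists a universal constant $K>0$ such that the following holds. Let $n\ge1$, let $\rho$ be an $n$-qubit mixed state, let $\mathcal{D}$ be a probability distribution over two-outcome measurements on $n$ qubits, and let $\mathcal{E}=(E_1,\ldots,E_m)$ consist of $m$ measurements drawn independently from $\mathcal{D}$. Fix $\varepsilon,\eta,\gamma>0$ with $\gamma>\eta$, and $\delta\in(0,1)$. Call $\mathcal{E}$ good if every $n$-qubit mixed state $\sigma$ with $|\operatorname{Tr}(E_i\sigma)-\operatorname{Tr}(E_i\rho)|\le\eta$ for all $i$ also satisfies $\Pr_{E\sim\mathcal{D}}[|\operatorname{Tr}(E\sigma)-\operatorname{Tr}(E\rho)|>\gamma]\le\varepsilon$. Then $\mathcal{E}$ is good with probability at least $1-\delta$, provided that \[m\ge\frac{K}{\varepsilon}\left(\frac{n}{(\gamma-\eta)^2}\log^2\frac{n}{(\gamma-\eta)\varepsilon}+\log\frac1\delta\right).\]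
   Context: An $n$-qubit mixed state is a $2^n\times2^n$ Hermitian positive semidefinite matrix of trace $1$. A two-outcome measurement on $n$ qubits is a $2^n\times2^n$ Hermitian matrix $E$ with eigenvalues in $[0,1]$; it accepts $\rho$ with probability $\operatorname{Tr}(E\rho)$. *)

(* Defs.v *)
From HB Require Import structures.
From mathcomp Require Import all_boot all_order all_algebra.
From mathcomp Require Import all_classical all_reals all_analysis.
From mathcomp Require Import complex.
Set Implicit Arguments. Unset Strict Implicit. Unset Printing Implicit Defensive.
Import Order.TTheory GRing.Theory Num.Theory.
Local Open Scope ring_scope.
Local Open Scope classical_set_scope.

Section QDefs.
Variable R : realType.
Local Notation C := R[i].

Definition adjmx (p q : nat) (A : 'M[C]_(p, q)) : 'M[C]_(q, p) :=
  (map_mx (@Num.conj C) A)^T.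

Definition hermitian (N : nat) (A : 'M[C]_N) : Prop := adjmx A = A.

(* positive semidefinite: Hermitian and v^* A v >= 0 for all v
   (in the order of C, 0 <= z means z is a nonnegative real) *)
Definition psd (N : nat) (A : 'M[C]_N) : Prop :=
  hermitian A /\ forall v : 'cV[C]_N, 0 <= (adjmx v *m A *m v) 0 0.

Definition mixed_state (n : nat) (rho : 'M[C]_(2 ^ n)) : Prop :=
  psd rho /\ \tr rho = 1.

Definition measurement (n : nat) (E : 'M[C]_(2 ^ n)) : Prop :=
  hermitian E /\ forall a : C, eigenvalue E a -> 0 <= a <= 1.

Definition accept (n : nat) (E rho : 'M[C]_(2 ^ n)) : C := \tr (E *m rho).

End QDefs.

Definition iid_with_law (R : realType) (d : measure_display) (Omega : measurableType d)
  (dT : measure_display) (T : measurableType dT)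
  (P : probability Omega R) (D : probability T R) (m : nat) (X : 'I_m -> Omega -> T) : Prop :=
  (forall i, measurable_fun setT (X i)) /\
  forall A : 'I_m -> set T, (forall i, measurable (A i)) ->
    P (\bigcap_(i in [set: 'I_m]) (X i @^-1` A i)) = (\prod_(i < m) D (A i))%E.

Definition good (R : realType) (dT : measure_display) (T : measurableType dT)
  (D : probability T R) (n : nat) (Emap : T -> 'M[R[i]]_(2 ^ n))
  (rho : 'M[R[i]]_(2 ^ n)) (eps eta gamma : R) (m : nat)
  (Es : 'I_m -> 'M[R[i]]_(2 ^ n)) : Prop :=
  forall sigma : 'M[R[i]]_(2 ^ n), mixed_state sigma ->
    (forall i, `|accept (Es i) sigma - accept (Es i) rho| <= (eta%:C)%C) ->
    (D [set t | (`|accept (Emap t) sigma - accept (Emap t) rho| > (gamma%:C)%C)%R]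
       <= eps%:E)%E.

(* Main.v *)
(* A state [S] is learned online by matrix multiplicative weights: a sum [A] of
   effects (with signs, centred at their predicted values) is updated at each
   prediction error larger than [a]. Each update multiplies [\tr (exp (s A))] by
   at most [1 + O(s^2)], whereas [exp (s \tr (A S)) <= \tr (exp (s A))] and
   [\tr (A S)] grows by [a] at each error, so that there are only [O(n / a^2)]
   errors. No Golden-Thompson inequality is needed: if [u_i] and [v_j] are the
   eigenvalues of two Hermitian matrices [A] and [B], then
   [\tr (g A * h B) = \sum_(i, j) g u_i * h v_j * w_ij] with [w] doubly
   stochastic, so that scalar inequalities between convex functions transfer.
   The list of the errors determines all predictions up to [a]; hence on [k]
   effects the states are covered, at scale [a], by [(2 k + 1) ^ O(n / a^2)]
   functions. A double-sample argument turns this covering number into a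
   generalization bound. After rounding the entries of the effects to a finite
   grid that argument only involves finite sums, and the supremum over the
   uncountably many states raises no measurability question. *)

Require Import Defs.
From HB Require Import structures.
From mathcomp Require Import all_boot all_order all_algebra.
From mathcomp Require Import all_classical all_reals all_analysis.
From mathcomp Require Import measurable_realfun complex ring lra.
Set Implicit Arguments. Unset Strict Implicit. Unset Printing Implicit Defensive.
Import Order.TTheory GRing.Theory Num.Theory.
Local Open Scope ring_scope.
Local Open Scope classical_set_scope.

(** * Elementary inequalities between real numbers *)

Section ScalarInequalities.
Variable R : realType.
Implicit Types x y : R.

(** Dividing by [expR y] leaves [e^u - 1 - u <= u^2 (e^u + 1)], which follows from
    [e^u - 1 - u <= u (e^u - 1)]. The two endpoint values in the remainder become the two Gibbs
    traces of [potential_taylor]. *)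
Lemma expR_taylor1 x y :
  expR x - expR y - expR y * (x - y) <= (x - y) ^+ 2 * (expR x + expR y).
Proof.
set u := x - y; have -> : expR x = expR y * expR u by rewrite -expRD /u addrC subrK.
have ey := expR_gt0 y; have eu := expR_gt0 u.
have h1 : expR u - 1 <= u * expR u.
  have := expR_ge1Dx (- u); rewrite expRN -(ler_pM2r eu) mulVf ?gt_eqF //; lra.
have h2 := expR_ge1Dx u.
have h3 : expR u - 1 - u <= u * (expR u - 1) by lra.
suff : expR u - 1 - u <= u ^+ 2 * (expR u + 1) by move=> h4; nra.
by apply: (le_trans h3); have [u0|u0] := lerP 0 u; nra.
Qed.

Lemma expRN2_le_1B x : 0 <= x <= 2^-1 -> expR (- (2 * x)) <= 1 - x.
Proof.
move=> /andP[x0 x1]; rewrite expRN.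
have h := expR_ge1Dx (2 * x).
have p : 0 < 1 + 2 * x by lra.
apply: (@le_trans _ _ (1 + 2 * x)^-1).
  by rewrite lef_pV2 // ?posrE ?expR_gt0.
rewrite -(ler_pM2r p) mulVf ?gt_eqF //; nra.
Qed.

Lemma natrX2_le_expR (n : nat) : 2 ^+ n <= expR n%:R :> R.
Proof.
rewrite -[n%:R]mulr1 expRM_natl lerXn2r ?nnegrE ?expR_ge0 //.
by have := expR_ge1Dx (1 : R); rewrite [1 + 1]addrC.
Qed.

Lemma expR_half_le x : 0 <= x <= 1 -> expR (x / 2) <= 1 + x.
Proof.
move=> /andP[x0 x1]; have h := expR_ge1Dx (- (x / 2)).
have p : 0 < 1 - x / 2 by lra.
rewrite -[x / 2]opprK expRN; apply: (@le_trans _ _ (1 - x / 2)^-1).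
  by rewrite lef_pV2 ?posrE ?expR_gt0.
by rewrite -(ler_pM2r p) mulVf ?gt_eqF //; nra.
Qed.

Lemma ln_ge_1BV x : 0 < x -> 1 - x^-1 <= ln x.
Proof.
move=> x0; have := expR_ge1Dx (- ln x).
by rewrite expRN lnK ?posrE // => h; lra.
Qed.

Lemma ler_dist_perturb (x y x' y' e b : R) : `|x - y| <= e ->
  `|x - x'| <= b -> `|y - y'| <= b -> `|x' - y'| <= e + 2 * b.
Proof.
rewrite !ler_norml => /andP[h1 h2] /andP[h3 h4] /andP[h5 h6].
by apply/andP; split; lra.
Qed.

End ScalarInequalities.

(** * Spectral calculus *)

Section FunctionalCalculus.
Context {R : realType} {N : nat}.
Local Notation C := R[i].
Implicit Types (A B : 'M[C]_N) (g h : R -> R).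

Definition eigval A (i : 'I_N) : R := complex.Re (spectral_diag A 0 i).

Definition fcalc g A : 'M[C]_N :=
  adjmx (spectralmx A) *m diag_mx (\row_j ((g (eigval A j))%:C)%C)
    *m spectralmx A.

(** Squared inner products between the eigenvectors of [A] and those of [B]: the doubly stochastic
    matrix of transition probabilities. *)
Definition overlap A B (i j : 'I_N) : R :=
  complex.Re (`|(spectralmx A *m adjmx (spectralmx B)) i j| ^+ 2).

Lemma adjmxE (p q : nat) (A : 'M[C]_(p, q)) : adjmx A = (map_mx Num.conj (A^T)).
Proof. by rewrite /adjmx map_trmx. Qed.

Lemma adjmxK (p q : nat) (A : 'M[C]_(p, q)) : adjmx (adjmx A) = A.
Proof. by apply/matrixP => i j; rewrite !mxE conjCK. Qed.

Lemma adjmxM (p q r : nat) (A : 'M[C]_(p, q)) (B : 'M[C]_(q, r)) :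
  adjmx (A *m B) = adjmx B *m adjmx A.
Proof. by rewrite /adjmx map_mxM trmx_mul. Qed.

Lemma spectralmxK A : spectralmx A *m adjmx (spectralmx A) = 1%:M.
Proof. by rewrite adjmxE; apply/unitarymxP/spectral_unitarymx. Qed.

Lemma adj_spectralmxK A : adjmx (spectralmx A) *m spectralmx A = 1%:M.
Proof. exact/mulmx1C/spectralmxK. Qed.

Lemma hermitian_hermsymmx A : Defs.hermitian A -> A \is hermitianmx N false (@Num.conj C).
Proof.
move=> hA; apply/is_hermitianmxP; rewrite expr0 scale1r -[LHS]hA.
by rewrite adjmxE.
Qed.

Lemma fcalc_id A : Defs.hermitian A -> fcalc id A = A.
Proof.
move=> /hermitian_hermsymmx hA.
have hE : A = invmx (spectralmx A) *m diag_mx (spectral_diag A) *m spectralmx A.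
  exact: (orthomx_spectralP (hermitian_normalmx hA)).
have hU : invmx (spectralmx A) = adjmx (spectralmx A).
  by rewrite adjmxE; exact: invmx_unitary (spectral_unitarymx A).
have hd : \row_j ((id (eigval A j))%:C)%C = spectral_diag A.
  apply/rowP => j; rewrite mxE /eigval RRe_real //.
  exact: (mxOverP (hermitian_spectral_diag_real hA)).
by rewrite /fcalc hd -hU -hE.
Qed.

Lemma fcalcM g h A : fcalc g A *m fcalc h A = fcalc (fun x => g x * h x) A.
Proof.
rewrite /fcalc !mulmxA -[_ *m spectralmx A *m adjmx _]mulmxA spectralmxK mulmx1.
congr (_ *m _); rewrite -!mulmxA mulmx_diag; congr (_ *m diag_mx _).
by apply/rowP => j; rewrite !mxE rmorphM.
Qed.

Lemma fcalcD g h A : fcalc g A + fcalc h A = fcalc (fun x => g x + h x) A.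
Proof.
rewrite /fcalc -mulmxDl -mulmxDr -raddfD; congr (_ *m diag_mx _ *m _).
by apply/rowP => j; rewrite !mxE rmorphD.
Qed.

Lemma fcalc_cst (c : R) A : fcalc (fun=> c) A = ((c%:C)%C)%:M.
Proof.
rewrite /fcalc (_ : \row_j _ = const_mx (c%:C)%C); last by apply/rowP => j; rewrite !mxE.
by rewrite diag_const_mx mul_mx_scalar -scalemxAl adj_spectralmxK scalemx1.
Qed.

Lemma overlap_ge0 A B i j : 0 <= overlap A B i j.
Proof.
have /andP[_]// : (0 : C) <= `|(spectralmx A *m adjmx (spectralmx B)) i j| ^+ 2.
  by rewrite exprn_ge0.
Qed.

Lemma overlapE A B i j :
  ((overlap A B i j)%:C)%C = `|(spectralmx A *m adjmx (spectralmx B)) i j| ^+ 2.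
Proof. by rewrite /overlap RRe_real // ger0_real// exprn_ge0. Qed.

(** By cyclicity this is the trace of [diag(g) W diag(h) W^*], where [W] is the unitary change of
    eigenbasis. *)
Lemma tr_fcalc2 g h A B : \tr (fcalc g A *m fcalc h B) =
  ((\sum_i \sum_j g (eigval A i) * h (eigval B j) * overlap A B i j)%:C)%C.
Proof.
set W := spectralmx A *m adjmx (spectralmx B).
have WE : spectralmx B *m adjmx (spectralmx A) = adjmx W by rewrite adjmxM adjmxK.
have WO i j : ((overlap A B i j)%:C)%C = `|W i j| ^+ 2 by rewrite overlapE.
rewrite /fcalc -!mulmxA mxtrace_mulC -!mulmxA WE !mulmxA.
rewrite -[_ *m spectralmx A *m _]mulmxA -/W; clearbody W.
rewrite rmorph_sum; apply: eq_bigr => i _; rewrite mxE rmorph_sum.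
apply: eq_bigr => j _; rewrite mul_mx_diag mul_diag_mx !mxE.
by rewrite !rmorphM /= WO normCK; ring.
Qed.

Lemma overlap_suml A B j : \sum_i overlap A B i j = 1.
Proof.
apply: complexI; rewrite rmorph_sum.
set W := spectralmx A *m adjmx (spectralmx B).
have WW : adjmx W *m W = 1%:M.
  rewrite adjmxM adjmxK -mulmxA (mulmxA (adjmx (spectralmx A))) adj_spectralmxK mul1mx.
  exact: spectralmxK.
transitivity ((adjmx W *m W) j j); last by rewrite WW mxE eqxx.
by rewrite mxE; apply: eq_bigr => i _; rewrite /= overlapE -/W normCKC !mxE.
Qed.

Lemma overlap_sumr A B i : \sum_j overlap A B i j = 1.
Proof.
apply: complexI; rewrite rmorph_sum.
set W := spectralmx A *m adjmx (spectralmx B).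
have WW : W *m adjmx W = 1%:M.
  rewrite adjmxM adjmxK -mulmxA (mulmxA (adjmx (spectralmx B))) adj_spectralmxK mul1mx.
  exact: spectralmxK.
transitivity ((W *m adjmx W) i i); last by rewrite WW mxE eqxx.
by rewrite mxE; apply: eq_bigr => j _; rewrite /= overlapE -/W normCK !mxE.
Qed.

Lemma tr_fcalc g A : \tr (fcalc g A) = ((\sum_i g (eigval A i))%:C)%C.
Proof.
have -> : fcalc g A = fcalc g A *m fcalc (fun=> 1) A by rewrite fcalc_cst mulmx1.
rewrite tr_fcalc2; congr (_%:C)%C; apply: eq_bigr => i _.
by under eq_bigr do rewrite mulr1; rewrite -mulr_sumr overlap_sumr mulr1.
Qed.

Lemma spectralmx_mul A : Defs.hermitian A ->
  spectralmx A *m A = diag_mx (\row_j ((eigval A j)%:C)%C) *m spectralmx A.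
Proof.
by move=> hA; rewrite -{2}(fcalc_id hA) /fcalc !mulmxA spectralmxK mul1mx.
Qed.

(** The quadratic form takes the value [eigval A i] at the [i]-th eigenvector. *)
Lemma psd_eigval_ge0 A i : psd A -> 0 <= eigval A i.
Proof.
move=> [hA /(_ (adjmx (row i (spectralmx A))))]; rewrite adjmxK.
rewrite -row_mul spectralmx_mul //.
have -> : adjmx (row i (spectralmx A)) = col i (adjmx (spectralmx A)).
  by apply/matrixP => a b; rewrite !mxE.
rewrite -row_mul colE mulmxA -colE -mulmxA spectralmxK mulmx1 !mxE eqxx mulr1n.
by rewrite ler0c.
Qed.

Lemma eigenvalue_eigval A i : Defs.hermitian A -> eigenvalue A ((eigval A i)%:C)%C.
Proof.
move=> hA; apply/eigenvalueP; exists (row i (spectralmx A)).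
  rewrite -row_mul spectralmx_mul // row_mul.
  by apply/rowP => j; rewrite -row_mul mul_diag_mx !mxE.
apply/eqP => r0; have /matrixP/(_ i i) := spectralmxK A.
have -> : (spectralmx A *m adjmx (spectralmx A)) i i =
    (row i (spectralmx A) *m adjmx (spectralmx A)) 0 i.
  by rewrite -row_mul [RHS]mxE.
by rewrite r0 mul0mx !mxE eqxx; apply/eqP; rewrite eq_sym oner_eq0.
Qed.

End FunctionalCalculus.

(** * The real Hilbert-Schmidt pairing *)

Section TracePairing.
Context {R : realType} {N : nat}.
Local Notation C := R[i].
Implicit Types (A B D : 'M[C]_N) (g h : R -> R).

Definition rtr A B : R := complex.Re (\tr (A *m B)).

Lemma rtrC A B : rtr A B = rtr B A.
Proof. by rewrite /rtr mxtrace_mulC. Qed.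

Lemma ReD (x y : C) : complex.Re (x + y) = complex.Re x + complex.Re y.
Proof. by case: x; case: y. Qed.

Lemma ReN (x : C) : complex.Re (- x) = - complex.Re x.
Proof. by case: x. Qed.

Lemma rtrDr A B D : rtr A (B + D) = rtr A B + rtr A D.
Proof. by rewrite /rtr mulmxDr mxtraceD ReD. Qed.

Lemma rtrNr A B : rtr A (- B) = - rtr A B.
Proof. by rewrite /rtr mulmxN raddfN ReN. Qed.

Lemma rtrBr A B D : rtr A (B - D) = rtr A B - rtr A D.
Proof. by rewrite rtrDr rtrNr. Qed.

Lemma rtrZr (c : R) A B : rtr A ((c%:C)%C *: B) = c * rtr A B.
Proof.
by rewrite /rtr -scalemxAr mxtraceZ; case: (\tr _) => x y /=; rewrite mul0r subr0.
Qed.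

Lemma rtrA A B D : rtr (A *m B) D = rtr A (B *m D).
Proof. by rewrite /rtr mulmxA. Qed.

Lemma rtr_fcalc2 g h A B : rtr (fcalc g A) (fcalc h B) =
  \sum_i \sum_j g (eigval A i) * h (eigval B j) * overlap A B i j.
Proof. by rewrite /rtr tr_fcalc2. Qed.

Lemma rtr_fcalc1 g A : rtr (fcalc g A) 1%:M = \sum_i g (eigval A i).
Proof. by rewrite /rtr mulmx1 tr_fcalc. Qed.

Lemma rtr_hermitian A B : Defs.hermitian A -> Defs.hermitian B ->
  \tr (A *m B) = ((rtr A B)%:C)%C.
Proof.
by move=> hA hB; rewrite /rtr -(fcalc_id hA) -(fcalc_id hB) tr_fcalc2.
Qed.

Lemma hermitianD A B : Defs.hermitian A -> Defs.hermitian B -> Defs.hermitian (A + B).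
Proof. by rewrite /Defs.hermitian /adjmx map_mxD linearD /= => -> ->. Qed.

Lemma hermitianZ (c : R) A : Defs.hermitian A -> Defs.hermitian ((c%:C)%C *: A).
Proof.
rewrite /Defs.hermitian /adjmx map_mxZ linearZ /= => ->.
by congr (_ *: _); exact: conjc_real.
Qed.

Lemma hermitianN A : Defs.hermitian A -> Defs.hermitian (- A).
Proof. by rewrite /Defs.hermitian /adjmx map_mxN linearN /= => ->. Qed.

Lemma hermitian_scalar (c : R) : Defs.hermitian (((c%:C)%C)%:M : 'M[C]_N).
Proof.
rewrite /Defs.hermitian /adjmx map_scalar_mx tr_scalar_mx.
by congr (_%:M); exact: conjc_real.
Qed.

Lemma overlapC A B i j : overlap A B i j = overlap B A j i.
Proof.
rewrite /overlap; congr complex.Re; congr (_ ^+ 2).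
rewrite -[RHS]norm_conjC; congr `|_|.
set U := spectralmx A; set V := spectralmx B.
have -> : U *m adjmx V = adjmx (V *m adjmx U) by rewrite adjmxM adjmxK.
by rewrite /adjmx 2!mxE.
Qed.

Lemma fcalc1 A : fcalc (fun=> 1) A = 1%:M.
Proof. exact: fcalc_cst. Qed.

(** Although [A] and [B] need not commute, each term of the expansion is a function of [A] times a
    function of [B], so [rtr_fcalc2] applies. *)
Lemma rtr_fcalc_diff g A B : Defs.hermitian A -> Defs.hermitian B ->
  rtr (fcalc g A) (B - A) =
  \sum_i \sum_j g (eigval A i) * (eigval B j - eigval A i) * overlap A B i j.
Proof.
move=> hA hB.
have -> : rtr (fcalc g A) (B - A) =
    rtr (fcalc g A) (fcalc id B) - rtr (fcalc (fun x => g x * x) A) (fcalc (fun=> 1) B).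
  by rewrite fcalc1 -fcalcM rtrA mulmx1 !fcalc_id // rtrBr.
rewrite !rtr_fcalc2 -sumrB; apply: eq_bigr => i _.
rewrite -sumrB; apply: eq_bigr => j _.
move: (eigval A i) (eigval B j) (overlap A B i j) => a b w /=.
by move: (g a) => c; ring.
Qed.

(** Of the mixed terms [BA] and [AB], the first also becomes a function of [A] times [B], by
    cyclicity of the trace. *)
Lemma rtr_fcalc_sqr_diff g A B : Defs.hermitian A -> Defs.hermitian B ->
  rtr (fcalc g A) ((B - A) *m (B - A)) =
  \sum_i \sum_j g (eigval A i) * (eigval B j - eigval A i) ^+ 2 * overlap A B i j.
Proof.
move=> hA hB.
have -> : rtr (fcalc g A) ((B - A) *m (B - A)) =
    rtr (fcalc g A) (fcalc (fun x => x * x) B)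
    - rtr (fcalc (fun x => g x * x) A) (fcalc id B)
    - rtr (fcalc (fun x => x * g x) A) (fcalc id B)
    + rtr (fcalc (fun x => g x * (x * x)) A) (fcalc (fun=> 1) B).
  rewrite fcalc1 -!fcalcM !fcalc_id //; move: (fcalc g A) => G.
  rewrite mulmxBl !mulmxBr !(rtrBr, rtrDr, rtrNr) !rtrA mulmx1.
  have -> : rtr A (G *m B) = rtr G (B *m A) by rewrite rtrC rtrA.
  move: (rtr G (B *m B)) (rtr G (B *m A)) (rtr G (A *m B)) (rtr G (A *m A)).
  by move=> a b c d; ring.
have hg h h' := rtr_fcalc2 h h' A B.
rewrite (hg g) (hg _ id) (hg _ id) (hg _ (fun=> 1)) {hg}.
rewrite -2!sumrB.
rewrite -big_split.
apply: eq_bigr => i _.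
rewrite -!sumrB -big_split; apply: eq_bigr => j _.
move: (eigval A i) (eigval B j) (overlap A B i j) => a b w /=.
by move: (g a) => c; ring.
Qed.

End TracePairing.

(** * The exponential potential and its updates *)

Section ExponentialPotential.
Context {R : realType} {N : nat}.
Local Notation C := R[i].
Implicit Types (A B D E : 'M[C]_N).

Definition effect E := Defs.hermitian E /\ forall i, 0 <= eigval E i <= 1.

Definition gibbs (s : R) A := fcalc (fun x => expR (s * x)) A.

Definition potential (s : R) A : R := \sum_i expR (s * eigval A i).

(** The expectation of [E] in the Gibbs state of [A]; [potential] is the partition function. *)
Definition prediction (s : R) A E : R := rtr (gibbs s A) E / potential s A.

(** Weighted by [overlap], both potentials become double sums over pairs of eigenvalues, and
    [expR_taylor1] applies term by term. *)
Lemma potential_taylor s A B : Defs.hermitian A -> Defs.hermitian B ->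
  potential s B - potential s A - s * rtr (gibbs s A) (B - A) <=
  s ^+ 2 * (rtr (gibbs s A) ((B - A) *m (B - A)) +
            rtr (gibbs s B) ((B - A) *m (B - A))).
Proof.
move=> hA hB.
(* The sign inside the square is reversed to expand the trace based at [B], then restored for the
   one based at [A]. *)
have -> : (B - A) *m (B - A) = (A - B) *m (A - B).
  by rewrite -(opprB A B) mulNmx mulmxN opprK.
rewrite [X in _ <= _ * (_ + X)]rtr_fcalc_sqr_diff //.
have -> : (A - B) *m (A - B) = (B - A) *m (B - A).
  by rewrite -(opprB A B) mulNmx mulmxN opprK.
rewrite rtr_fcalc_sqr_diff // rtr_fcalc_diff // /potential.
have -> : \sum_i expR (s * eigval B i) =
    \sum_i \sum_j expR (s * eigval B j) * overlap A B i j.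
  rewrite exchange_big; apply: eq_bigr => j _ /=.
  by rewrite -mulr_sumr overlap_suml mulr1.
have -> : \sum_i expR (s * eigval A i) =
    \sum_i \sum_j expR (s * eigval A i) * overlap A B i j.
  by apply: eq_bigr => i _; rewrite -mulr_sumr overlap_sumr mulr1.
rewrite [X in _ <= _ * (_ + X)]exchange_big /= mulr_sumr -!sumrB.
rewrite -big_split mulr_sumr; apply: ler_sum => i _ /=.
rewrite mulr_sumr -!sumrB -big_split mulr_sumr; apply: ler_sum => j _ /=.
rewrite (overlapC B A); have := overlap_ge0 A B i j.
move: (eigval A i) (eigval B j) (overlap A B i j) => a b w w0.
have := expR_taylor1 (s * b) (s * a).
move: (expR (s * a)) (expR (s * b)) => ea eb h.
have := ler_wpM2r w0 h; lra.
Qed.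

(** The spectrum of [E - y] lies in [[-1, 1]], so its square is at most the identity. *)
Lemma rtr_gibbs_effect_sqr s A E (y : R) : effect E -> 0 <= y <= 1 ->
  rtr (gibbs s A) ((E - ((y%:C)%C)%:M) *m (E - ((y%:C)%C)%:M)) <= potential s A.
Proof.
move=> [hE E01] /andP[y0 y1].
have -> : E - ((y%:C)%C)%:M = fcalc (fun x => x - y) E.
  by rewrite -fcalcD fcalc_id // fcalc_cst rmorphN raddfN.
rewrite fcalcM rtr_fcalc2; apply: ler_sum => i _.
rewrite -[leRHS]mulr1 -(overlap_sumr A E i) mulr_sumr; apply: ler_sum => j _.
rewrite ler_wpM2r ?overlap_ge0 // ler_piMr ?expR_ge0 //.
have /andP[] := E01 j; nra.
Qed.

Lemma potential_gt0 s A : (0 < N)%N -> 0 < potential s A.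
Proof.
move=> N0; rewrite /potential (bigD1 (Ordinal N0)) //=.
by rewrite ltr_wpDr ?expR_gt0 // sumr_ge0 // => i _; rewrite expR_ge0.
Qed.

Lemma prediction01 s A E : (0 < N)%N -> effect E -> 0 <= prediction s A E <= 1.
Proof.
move=> N0 [hE E01]; have p0 := potential_gt0 s A N0.
have -> : prediction s A E = rtr (gibbs s A) (fcalc id E) / potential s A.
  by rewrite fcalc_id.
rewrite rtr_fcalc2; apply/andP; split.
  apply: divr_ge0; last exact: ltW.
  apply: sumr_ge0 => i _; apply: sumr_ge0 => j _.
  by rewrite !mulr_ge0 ?expR_ge0 ?overlap_ge0 //; have /andP[] := E01 j.
rewrite ler_pdivrMr // mul1r; apply: ler_sum => i _.
rewrite -[leRHS]mulr1 -(overlap_sumr A E i) mulr_sumr; apply: ler_sum => j _.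
rewrite ler_wpM2r ?overlap_ge0 // ler_piMr ?expR_ge0 //.
by have /andP[] := E01 j.
Qed.

(** Centring [E] at its prediction cancels the first-order change of the potential. In
    [learn_or_mistake], [b] says that the prediction was too low. *)
Definition update s A (b : bool) E : 'M[C]_N :=
  let D := E - (((prediction s A E)%:C)%C)%:M in if b then A + D else A - D.

Lemma hermitian_update s A b E : Defs.hermitian A -> effect E ->
  Defs.hermitian (update s A b E).
Proof.
move=> hA [hE _].
have hD : Defs.hermitian (E - (((prediction s A E)%:C)%C)%:M).
  exact: hermitianD hE (hermitianN (hermitian_scalar _)).
by case: b; [exact: hermitianD | exact: hermitianD hA (hermitianN hD)].
Qed.

(** Only the second-order term of [potential_taylor] survives; it is at most [s^2] times the sum of
    the two potentials. *)
Lemma potential_update s A b E : (0 < N)%N -> Defs.hermitian A -> effect E ->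
  (1 - s ^+ 2) * potential s (update s A b E) <= (1 + s ^+ 2) * potential s A.
Proof.
move=> N0 hA eE; have p0 := potential_gt0 s A N0.
have y01 := prediction01 s A N0 eE.
have hB := hermitian_update s b hA eE.
set B := update s A b E; have := potential_taylor s hA hB; rewrite -/B.
set D := E - (((prediction s A E)%:C)%C)%:M.
have DD : (B - A) *m (B - A) = D *m D.
  rewrite /B /update -/D; case: b {hB B}; rewrite addrAC subrr add0r //.
  by rewrite mulNmx mulmxN opprK.
have lin : rtr (gibbs s A) (B - A) = 0.
  have D0 : rtr (gibbs s A) D = 0.
    rewrite rtrBr -[_%:M]scalemx1 rtrZr rtr_fcalc1 -/(potential s A).
    by rewrite /prediction divfK ?subrr // gt_eqF.
  by rewrite /B /update -/D; case: b {hB B DD}; rewrite addrAC subrr add0r // rtrNr D0 oppr0.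
rewrite DD lin mulr0 subr0.
have hAD : rtr (gibbs s A) (D *m D) <= potential s A := rtr_gibbs_effect_sqr s A eE y01.
have hBD : rtr (gibbs s B) (D *m D) <= potential s B := rtr_gibbs_effect_sqr s B eE y01.
move: (ler_wpM2l (sqr_ge0 s) (lerD hAD hBD)).
by move: (potential s A) (potential s B) (s ^+ 2) (rtr _ _ + _); clear => u v t x; lra.
Qed.

Definition state A := Defs.psd A /\ \tr A = 1.

Lemma state_eigval A : state A ->
  [/\ Defs.hermitian A, forall i, 0 <= eigval A i & \sum_i eigval A i = 1].
Proof.
move=> [pA tA]; split=> [|i|]; [by case: pA | exact: psd_eigval_ge0 |].
by apply: complexI; rewrite -(tr_fcalc id) fcalc_id //; case: pA.
Qed.

(** [\tr (A S)] is an average of the eigenvalues of [A], hence at most one of them, whose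
    exponential is a summand of the potential. *)
Lemma expR_rtr_le_potential s A S : 0 <= s -> Defs.hermitian A -> state S ->
  expR (s * rtr A S) <= potential s A.
Proof.
move=> s0 hA /state_eigval[hS S0 S1].
pose q i := \sum_j eigval S j * overlap A S i j.
have q0 i : 0 <= q i by apply: sumr_ge0 => j _; rewrite mulr_ge0 ?overlap_ge0.
have q1 : \sum_i q i = 1.
  rewrite exchange_big /= -S1; apply: eq_bigr => j _.
  by rewrite -mulr_sumr overlap_suml mulr1.
have rE : rtr A S = \sum_i eigval A i * q i.
  rewrite -(fcalc_id hA) -(fcalc_id hS) rtr_fcalc2; apply: eq_bigr => i _.
  by rewrite mulr_sumr; apply: eq_bigr => j _; rewrite mulrA !fcalc_id.
(* If all eigenvalues were below the average, the positive gaps would force every weight [q i] to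
   vanish. *)
have [i hi] : exists i, rtr A S <= eigval A i.
  apply: contrapT => /forallNP h.
  have {h}h i : eigval A i < rtr A S by rewrite ltNge; apply/negP.
  have e : \sum_i (rtr A S - eigval A i) * q i = 0.
    under eq_bigr do rewrite mulrBl.
    by rewrite sumrB -mulr_sumr q1 mulr1 -rE subrr.
  have /eqP := q1; rewrite big1 => [|i _]; first by rewrite eq_sym oner_eq0.
  move/eqP: e; rewrite psumr_eq0 => [/allP/(_ i)|j _]; last first.
    by rewrite mulr_ge0 // subr_ge0 ltW.
  by rewrite mem_index_enum => /(_ isT); rewrite mulf_eq0 subr_eq0 gt_eqF //= => /eqP.
rewrite /potential (bigD1 i) //= ler_wpDr //.
  by apply: sumr_ge0 => *; exact: expR_ge0.
by rewrite ler_expR ler_wpM2l.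
Qed.

End ExponentialPotential.

(** * Hilbert-Schmidt norm and entrywise bounds *)

Section HilbertSchmidt.
Context {R : realType} {N : nat}.
Local Notation C := R[i].
Implicit Types A B E S : 'M[C]_N.

Lemma rtr_sqr A : Defs.hermitian A -> rtr A A = \sum_i eigval A i ^+ 2.
Proof.
move=> hA; rewrite /rtr -{1 2}(fcalc_id hA) fcalcM tr_fcalc /=.
by apply: eq_bigr => i _; rewrite expr2.
Qed.

Lemma rtr_sqr_entries A : Defs.hermitian A ->
  rtr A A = \sum_k \sum_l (complex.Re (A k l) ^+ 2 + complex.Im (A k l) ^+ 2).
Proof.
move=> hA; apply: complexI; rewrite -rtr_hermitian // rmorph_sum.
apply: eq_bigr => k _; rewrite mxE rmorph_sum; apply: eq_bigr => l _.
have -> : A l k = (A k l)^*%C by rewrite -{1}hA !mxE.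
case: (A k l) => x y; rewrite /= /GRing.mul /=; congr Complex; ring.
Qed.

Lemma entry_sqr_le A k l : Defs.hermitian A ->
  complex.Re (A k l) ^+ 2 + complex.Im (A k l) ^+ 2 <= \sum_i eigval A i ^+ 2.
Proof.
move=> hA; rewrite -rtr_sqr // rtr_sqr_entries // (bigD1 k) //= (bigD1 l) //= -addrA.
rewrite lerDl addr_ge0 // ?sumr_ge0 // => i _; first by rewrite addr_ge0 ?sqr_ge0.
by apply: sumr_ge0 => j _; rewrite addr_ge0 ?sqr_ge0.
Qed.

Lemma state_sqr_le1 S : state S -> \sum_i eigval S i ^+ 2 <= 1.
Proof.
move=> /state_eigval[_ S0 S1]; rewrite -S1; apply: ler_sum => i _.
rewrite expr2 ler_piMr // -S1 (bigD1 i) //= lerDl.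
exact: sumr_ge0.
Qed.

Lemma rtr_entries A B :
  rtr A B = \sum_k \sum_l (complex.Re (A k l) * complex.Re (B l k)
                           - complex.Im (A k l) * complex.Im (B l k)).
Proof.
have ReS (I : finType) (F : I -> C) : complex.Re (\sum_i F i) = \sum_i complex.Re (F i).
  by elim/big_rec2: _ => // i x y _ <-; rewrite ReD.
rewrite /rtr ReS; apply: eq_bigr => k _; rewrite mxE ReS; apply: eq_bigr => l _.
by case: (A k l) => a b; case: (B l k).
Qed.

(** This controls rounding errors. A state has Hilbert-Schmidt norm at most [1], which bounds the
    real and imaginary parts of its entries; each of the [N^2] products then costs at most
    [2 * h]. *)
Lemma rtr_state_le A S (h : R) : state S ->
  (forall k l, `|complex.Re (A k l)| <= h /\ `|complex.Im (A k l)| <= h) ->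
  `|rtr A S| <= 2 * N%:R ^+ 2 * h.
Proof.
move=> stS hA; have [hS _ _] := state_eigval stS.
rewrite rtr_entries; apply: (le_trans (ler_norm_sum _ _ _)).
have sum_cst (c : R) : \sum_(k < N) c = c * N%:R.
  by rewrite big_const_ord iter_addr_0 mulr_natr.
have -> : 2 * N%:R ^+ 2 * h = \sum_(k < N) \sum_(l < N) (2 * h).
  rewrite 2!sum_cst expr2.
  by rewrite mulrAC mulrA.
apply: ler_sum => k _; apply: (le_trans (ler_norm_sum _ _ _)).
apply: ler_sum => l _; apply: (le_trans (ler_normB _ _)); rewrite 2!normrM.
have [hr hi] := hA k l.
have := le_trans (entry_sqr_le l k hS) (state_sqr_le1 stS).
move: (complex.Re (S l k)) (complex.Im (S l k)) => x y xy.
have x1 : `|x| <= 1.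
  rewrite -(@ler_pXn2r _ 2) ?nnegrE // expr1n real_normK ?num_real //.
  by move: xy (sqr_ge0 y); clear; lra.
have y1 : `|y| <= 1.
  rewrite -(@ler_pXn2r _ 2) ?nnegrE // expr1n real_normK ?num_real //.
  by move: xy (sqr_ge0 x); clear; lra.
have e1 := ler_pM (normr_ge0 _) (normr_ge0 _) hr x1.
have e2 := ler_pM (normr_ge0 _) (normr_ge0 _) hi y1.
by rewrite mulr_natl mulr2n; apply: lerD; rewrite -[leRHS]mulr1.
Qed.

Lemma rtr_effect_state E S : effect E -> state S -> 0 <= rtr E S <= 1.
Proof.
move=> [hE E01] /state_eigval[hS S0 S1].
rewrite -(fcalc_id hE) -(fcalc_id hS) rtr_fcalc2; apply/andP; split.
  apply: sumr_ge0 => i _; apply: sumr_ge0 => j _.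
  by rewrite !mulr_ge0 ?overlap_ge0 //; have /andP[] := E01 i.
rewrite -S1 exchange_big; apply: ler_sum => j _ /=.
rewrite -[leRHS]mulr1 -(overlap_suml E S j) mulr_sumr; apply: ler_sum => i _.
rewrite ler_wpM2r ?overlap_ge0 // ler_piMl //.
by have /andP[] := E01 i.
Qed.

End HilbertSchmidt.

(** * Online learning of states *)

Section OnlineLearning.
Context {R : realType} {N : nat} {I : finType}.
Local Notation C := R[i].
Variables (s a : R) (Es : I -> 'M[C]_N).
Hypothesis N_gt0 : (0 < N)%N.
Hypothesis effectE : forall i, effect (Es i).

(** The head of [L] is the latest error; learning starts from [0], whose Gibbs state is maximally
    mixed. *)
Definition hypothesis (L : seq (I * bool)) : 'M[C]_N :=
  foldr (fun ib A => update s A ib.2 (Es ib.1)) 0 L.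

Lemma hermitian_hypothesis L : Defs.hermitian (hypothesis L).
Proof.
elim: L => [|ib L IH] /=; last exact: hermitian_update.
by rewrite /Defs.hermitian /adjmx map_mx0 trmx0.
Qed.

(** The eigenbasis chosen for [0] is not explicit, so the argument goes through the trace of the
    square, which is the sum of the squared eigenvalues. *)
Lemma eigval0 i : eigval (0 : 'M[C]_N) i = 0.
Proof.
have h0 : Defs.hermitian (0 : 'M[C]_N) by rewrite /Defs.hermitian /adjmx map_mx0 trmx0.
have : \tr (fcalc (fun x => x ^+ 2) (0 : 'M[C]_N)) = 0.
  by rewrite -(fcalcM id id) fcalc_id // mul0mx mxtrace0.
rewrite tr_fcalc => /(congr1 (@complex.Re R)) /= /eqP.
rewrite psumr_eq0 => [/allP/(_ i)|j _]; last exact: sqr_ge0.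
by rewrite mem_index_enum => /(_ isT); rewrite sqrf_eq0 => /eqP.
Qed.

Lemma potential_hypothesis L : s ^+ 2 <= 1 ->
  (1 - s ^+ 2) ^+ size L * potential s (hypothesis L) <=
  (1 + s ^+ 2) ^+ size L * N%:R.
Proof.
move=> s1; have s2 := sqr_ge0 s; elim: L => [|ib L IH] /=.
  rewrite !expr0 !mul1r /potential; under eq_bigr do rewrite eigval0 mulr0 expR0.
  by rewrite sumr_const card_ord.
have h := potential_update s ib.2 N_gt0 (hermitian_hypothesis L) (effectE ib.1).
rewrite exprSr -mulrA; apply: (@le_trans _ _ ((1 - s ^+ 2) ^+ size L *
    ((1 + s ^+ 2) * potential s (hypothesis L)))).
  by rewrite ler_wpM2l // exprn_ge0 // subr_ge0.
rewrite mulrCA [X in _ <= X * _]exprS -[leRHS]mulrA ler_wpM2l //; lra.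
Qed.

(** By induction on [k]: while some effect is mispredicted by more than [a], an update towards its
    true value raises [\tr (A S)] by the size of the error. *)
Lemma learn_or_mistake S k : state S ->
  (exists2 L, (size L <= k)%N &
    forall i, `|prediction s (hypothesis L) (Es i) - rtr (Es i) S| <= a) \/
  (exists2 L, size L = k & a * k%:R <= rtr (hypothesis L) S).
Proof.
move=> stS; elim: k => [|k [[L Lk hL]|[L Lk hL]]].
- by right; exists [::] => //=; rewrite mulr0 /rtr mul0mx mxtrace0.
- by left; exists L => //; exact: leqW.
have [[i hi]|nh] := pselect (exists i, a < `|prediction s (hypothesis L) (Es i) - rtr (Es i) S|);
  last first.
  left; exists L; first by rewrite Lk.
  by move=> i; rewrite leNgt; apply/negP => hi; apply: nh; exists i.
right.
set y := prediction s (hypothesis L) (Es i) in hi.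
have S1 : rtr S 1%:M = 1 by case: stS => _ tS; rewrite /rtr mulmx1 tS.
exists ((i, y < rtr (Es i) S) :: L); first by rewrite /= Lk.
have D1 : rtr S (Es i - ((y%:C)%C)%:M) = rtr (Es i) S - y.
  by rewrite rtrBr rtrC -[_%:M]scalemx1 rtrZr S1 mulr1.
rewrite mulrS mulrDr mulr1 rtrC /= /update -/y; case: ltP => hy.
  rewrite rtrDr D1 rtrC; move: hL hi; rewrite ltr0_norm ?subr_lt0 //.
  by move: (rtr _ _) (rtr _ _) (y) (k%:R) => u v z c; lra.
rewrite rtrBr D1 rtrC; move: hL hi; rewrite ger0_norm ?subr_ge0 //.
by move: (rtr _ _) (rtr _ _) (y) (k%:R) => u v z c; lra.
Qed.

End OnlineLearning.

(** After [T] errors the two bounds on the potential give [s a T - 2 s^2 T <= s^2 T + n]. The rate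
    [s = a / 6] maximizes [s a - 3 s^2] and yields [a^2 T <= 12 n], a contradiction. *)
Lemma learn (R : realType) (n T : nat) (I : finType) (a : R)
    (Es : I -> 'M[R[i]]_(2 ^ n)) (S : 'M[R[i]]_(2 ^ n)) :
  (forall i, effect (Es i)) -> state S -> 0 < a <= 1 ->
  12 * n%:R < a ^+ 2 * T%:R ->
  exists2 L, (size L <= T)%N &
    forall i, `|prediction (a / 6) (hypothesis (a / 6) Es L) (Es i) - rtr (Es i) S| <= a.
Proof.
move=> eE stS /andP[a0 a1] hT.
have N0 : (0 < 2 ^ n)%N by rewrite expn_gt0.
have [//|[L LT hL]] := learn_or_mistake (a / 6) a Es T stS; exfalso.
set s := a / 6 in hL.
have s0 : 0 <= s by rewrite /s; lra.
have s2 : s ^+ 2 <= 2^-1 by rewrite /s expr2; nra.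
have h1 : (1 - s ^+ 2) ^+ T * potential s (hypothesis s Es L) <=
    (1 + s ^+ 2) ^+ T * (2 ^ n)%:R.
  by rewrite -LT; apply: potential_hypothesis => //; lra.
have h2 := expR_rtr_le_potential s0 (hermitian_hypothesis s eE L) stS.
have h3 : expR (s * (a * T%:R)) <= potential s (hypothesis s Es L).
  by apply: le_trans h2; rewrite ler_expR ler_wpM2l.
have n2 : (2 ^ n)%:R <= expR (n%:R) :> R.
  by rewrite natrX natrX2_le_expR.
have h4 : expR (- (2 * s ^+ 2)) ^+ T <= (1 - s ^+ 2) ^+ T.
  rewrite lerXn2r ?nnegrE ?expR_ge0 //; last first.
    by apply: expRN2_le_1B; rewrite sqr_ge0.
  by lra.
have h5 : (1 + s ^+ 2) ^+ T <= expR (s ^+ 2) ^+ T.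
  rewrite lerXn2r ?nnegrE ?expR_ge0 ?expR_ge1Dx //.
  by have := sqr_ge0 s; lra.
have : expR (T%:R * - (2 * s ^+ 2) + s * (a * T%:R)) <= expR (T%:R * s ^+ 2 + n%:R).
  rewrite !expRD !expRM_natl; apply: (le_trans (ler_pM _ _ h4 h3)).
  - by rewrite exprn_ge0 // expR_ge0.
  - exact: expR_ge0.
  apply: (le_trans h1); apply: ler_pM => //.
  by rewrite exprn_ge0 // addr_ge0 // sqr_ge0.
rewrite ler_expR /s; move: hT; rewrite !expr2; lra.
Qed.

Lemma effect_cover (R : realType) (n T : nat) (I : finType) (a : R)
    (Es : I -> 'M[R[i]]_(2 ^ n)) :
  (forall i, effect (Es i)) -> 0 < a <= 1 -> 12 * n%:R < a ^+ 2 * T%:R ->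
  exists G : T.-tuple (option (I * bool)) -> I -> R,
  forall S : 'M[R[i]]_(2 ^ n), state S ->
    exists t, forall i, `|G t i - rtr (Es i) S| <= a.
Proof.
move=> eE a01 hT.
exists (fun t i => prediction (a / 6) (hypothesis (a / 6) Es (pmap id t)) (Es i)).
move=> S stS; have [L LT hL] := learn eE stS a01 hT.
(* Padding with [None] turns the lists of length at most [T] into one finite type; [pmap id] removes
   the padding. *)
have sz : size (map some L ++ nseq (T - size L) None) == T.
  by rewrite size_cat size_map size_nseq subnKC.
exists (Tuple sz) => i /=; rewrite pmap_cat -[map some L]/(map (fun x => Some x) L).
have -> : pmap id [seq Some x | x <- L] = L by elim: L {LT hL sz} => //= x L ->.
have -> : pmap id (nseq (T - size L) (@None (I * bool))) = [::] by elim: (T - size L)%N.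
by rewrite cats0.
Qed.

(** * Symmetrization over a finite alphabet *)

Section DoubleSample.
Context {R : realType} {J : finType} {m : nat}.
Local Notation sample := {ffun 'I_m -> J}.
Implicit Types (x y : sample) (c : {ffun 'I_m -> bool}).

Definition swap c (xy : sample * sample) : sample * sample :=
  ([ffun i => if c i then xy.2 i else xy.1 i],
   [ffun i => if c i then xy.1 i else xy.2 i]).

Lemma swapK c : involutive (swap c).
Proof. by case=> x y; congr pair; apply/ffunP => i; rewrite !ffunE /=; case: (c i). Qed.

Variable p : J -> R.
Hypothesis p_ge0 : forall j, 0 <= p j.
Hypothesis p_sum1 : \sum_j p j = 1.

Definition weight x := \prod_i p (x i).

Lemma weight_ge0 x : 0 <= weight x.
Proof. by apply: prodr_ge0. Qed.

Lemma sum_weight_prod (F : 'I_m -> J -> R) :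
  \sum_x weight x * \prod_i F i (x i) = \prod_i \sum_j p j * F i j.
Proof.
rewrite bigA_distr_bigA; apply: eq_bigr => x _.
by rewrite /weight -big_split.
Qed.

Lemma sum_weight : \sum_x weight x = 1.
Proof.
transitivity (\prod_(i < m) \sum_j p j * 1).
  rewrite -(sum_weight_prod (fun _ _ => 1)); apply: eq_bigr => x _.
  by rewrite big1 ?mulr1.
rewrite prodr_const (eq_bigr p) ?p_sum1 ?expr1n // => j _.
by rewrite mulr1.
Qed.

Lemma weight_swap c xy :
  weight (swap c xy).1 * weight (swap c xy).2 = weight xy.1 * weight xy.2.
Proof.
rewrite /weight -!big_split; apply: eq_bigr => i _ /=.
by rewrite !ffunE; case: (c i); rewrite // mulrC.
Qed.

(** Each of the [2 ^+ m] swaps is an involution preserving the product weight. *)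
Lemma sum_swap (F : sample * sample -> R) :
  2 ^+ m * \sum_xy weight xy.1 * weight xy.2 * F xy =
  \sum_xy weight xy.1 * weight xy.2 * \sum_c F (swap c xy).
Proof.
have -> : (2 : R) ^+ m = \sum_(c : {ffun 'I_m -> bool}) 1.
  by rewrite sumr_const card_ffun card_bool card_ord natrX.
rewrite mulr_suml.
transitivity (\sum_(c : {ffun 'I_m -> bool}) \sum_xy weight xy.1 * weight xy.2 * F (swap c xy)).
  apply: eq_bigr => c _; rewrite mul1r (reindex_inj (inv_inj (@swapK c))) /=.
  by apply: eq_bigr => xy _; rewrite weight_swap.
by rewrite exchange_big; apply: eq_bigr => xy _; rewrite mulr_sumr.
Qed.

Variables (S : Type) (f : S -> J -> R) (f0 : J -> R) (eta a eps : R) (M : finType).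

(** Passing to a cover element costs [a], so points fitted up to [eta] and far points end on
    opposite sides of [eta + a]. *)
Definition far s : pred J := fun j => eta + 2 * a < `|f s j - f0 j|.

Hypothesis eps_ge0 : 0 <= eps.
Hypothesis covering : forall z : 'I_m * bool -> J,
  exists G : M -> 'I_m * bool -> R,
  forall s, exists t, forall i, `|G t i - f s (z i)| <= a.

(* Each point of the second sample on which the hypothesis is far off is given
   weight [2]. On average over the swaps this compensates exactly for the
   constraint that the first sample contains no such point, so that each cell of
   the cover contributes at most [1], whereas a hypothesis of error [> eps]
   has expected weight at least [(1 + eps) ^+ m]. *)
Lemma double_sample (bad : pred sample) :
  (forall x, bad x -> exists s, (forall i, `|f s (x i) - f0 (x i)| <= eta) /\
     eps < \sum_(j | far s j) p j) ->
  (\sum_(x | bad x) weight x) * (1 + eps) ^+ m <= #|M|%:R.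
Proof.
move=> badP.
have [[x0 bx0]|nobad] := pselect (exists x, bad x); last first.
  rewrite big_pred0 ?mul0r // => x; apply/negP => bx; apply: nobad; by exists x.
have [s0 _] := badP x0 bx0.
(* The hypothesis depends on the first sample alone, so the second sample is independent of it; [s0]
   is a default value. *)
have [h hP] : exists h : sample -> S, forall x, bad x ->
    (forall i, `|f (h x) (x i) - f0 (x i)| <= eta) /\ eps < \sum_(j | far (h x) j) p j.
  have /choice[h hP] : forall x, exists s, bad x ->
      (forall i, `|f s (x i) - f0 (x i)| <= eta) /\ eps < \sum_(j | far s j) p j.
    move=> x; case bx: (bad x); last by exists s0.
    by have [s hs] := badP x bx; exists s.
  by exists h.
pose F (xy : sample * sample) : R :=
  (bad xy.1)%:R * \prod_i 2 ^+ far (h xy.1) (xy.2 i).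
apply: (@le_trans _ _ (\sum_xy weight xy.1 * weight xy.2 * F xy)).
  rewrite -(pair_bigA _ (fun x y => weight x * weight y * F (x, y))) /=.
  rewrite mulr_suml big_mkcond; apply: ler_sum => x _; rewrite /F /=.
  case: ifP => bx; last first.
    by rewrite big1 // => y _; rewrite mul0r mulr0.
  have [_ hx] := hP x bx.
  under eq_bigr do rewrite mul1r -mulrA.
  rewrite -mulr_sumr ler_wpM2l ?weight_ge0 //.
  rewrite (sum_weight_prod (fun _ j => 2 ^+ far (h x) j)).
  rewrite prodr_const card_ord lerXn2r ?nnegrE ?addr_ge0 //.
    by apply: sumr_ge0 => j _; rewrite mulr_ge0 // exprn_ge0.
  have -> : \sum_j p j * 2 ^+ far (h x) j = 1 + \sum_(j | far (h x) j) p j.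
    rewrite -[X in X + _]p_sum1 [X in _ + X]big_mkcond -big_split; apply: eq_bigr => j _ /=.
    by case: (far _ _); rewrite ?expr0 ?expr1; lra.
  by rewrite lerD2l ltW.
rewrite -(ler_pM2l (exprn_gt0 m (ltr0n R 2))) sum_swap.
apply: (@le_trans _ _ (\sum_xy weight xy.1 * weight xy.2 * (2 ^+ m * #|M|%:R))).
  apply: ler_sum => -[x y] _; rewrite ler_wpM2l ?mulr_ge0 ?weight_ge0 //=.
  (* One cover serves all swaps, since they only redistribute the same [2 m] points. *)
  have [G GP] := covering (fun ib => if ib.2 then y ib.1 else x ib.1).
  pose z (ib : 'I_m * bool) := if ib.2 then y ib.1 else x ib.1.
  pose out t ib := eta + a < `|G t ib - f0 (z ib)|.
  have hF : \sum_c F (swap c (x, y)) <=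
      \sum_(c : {ffun 'I_m -> bool}) \sum_t \prod_i
      ((~~ out t (i, c i))%:R * 2 ^+ out t (i, ~~ c i)).
    apply: ler_sum => c _.
    have pos t : 0 <= \prod_i ((~~ out t (i, c i))%:R * 2 ^+ out t (i, ~~ c i) : R).
      by apply: prodr_ge0 => i _; rewrite mulr_ge0 // exprn_ge0.
    rewrite /F /=; set x' := [ffun i => _]; set y' := [ffun i => _].
    have x'E i : x' i = z (i, c i) by rewrite ffunE /z /=; case: (c i).
    have y'E i : y' i = z (i, ~~ c i) by rewrite ffunE /z /=; case: (c i).
    case bx: (bad x'); last by rewrite mul0r; apply: sumr_ge0.
    have [hx _] := hP _ bx; have [t tP] := GP (h x').
    rewrite mul1r (bigD1 t) //=; apply: ler_wpDr; first exact: sumr_ge0.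
    apply: ler_prod => i _; rewrite exprn_ge0 //=.
    have -> : out t (i, c i) = false.
      have h2 : `|G t (i, c i) - f (h x') (z (i, c i))| <= a := tP (i, c i).
      apply/negbTE; rewrite /out -leNgt -x'E; rewrite -x'E in h2; have h1 := hx i.
      have := ler_normD (G t (i, c i) - f (h x') (x' i)) (f (h x') (x' i) - f0 (x' i)).
      by rewrite addrA subrK; lra.
    rewrite mul1r; apply: ler_weXn2l; first lra.
    case far1: (far _ _) => //; suff -> : out t (i, ~~ c i) by [].
    move: far1; rewrite /far /out y'E => far1.
    have h2 : `|G t (i, ~~ c i) - f (h x') (z (i, ~~ c i))| <= a := tP (i, ~~ c i).
    have := ler_normB (G t (i, ~~ c i) - f0 (z (i, ~~ c i)))
       (G t (i, ~~ c i) - f (h x') (z (i, ~~ c i))).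
    rewrite opprB addrC addrA subrK; lra.
  apply: (le_trans hF); rewrite exchange_big /= -sum1_card natr_sum mulr_sumr.
  apply: ler_sum => t _; rewrite mulr1.
  (* The sum over swaps factors over coordinates. A coordinate contributes [1 + 1] if neither point
     is out, [0 + 2] if one is, and [0] if both are. *)
  rewrite -(bigA_distr_bigA (fun i b => (~~ out t (i, b))%:R * 2 ^+ out t (i, ~~ b) : R)).
  rewrite -[X in _ <= _ ^+ X](card_ord m) -prodr_const; apply: ler_prod => i _.
  rewrite big_bool /=.
  by case: (out t (i, true)); case: (out t (i, false)); rewrite /= ?expr0 ?expr1; lra.
rewrite -mulr_suml -(pair_bigA _ (fun x y => weight x * weight y)) /=.
under eq_bigr do rewrite -mulr_sumr sum_weight mulr1.
by rewrite sum_weight mul1r.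
Qed.

End DoubleSample.

(** * Sample size *)

Section SampleSize.
Variable R : realType.
Implicit Types D eps delta : R.

(** It suffices that [T log (4 m + 1) <= m eps / 2 - d]. Here [T] is of order [A], and the logarithm
    is bounded by a linear function of [m] with small slope, [12 + 2 l + 5 m / c]. *)
Lemma sample_size_bound (n m : nat) D eps delta :
  (1 <= n)%N -> 0 < D < 1 -> 0 < eps < 1 -> 0 < delta < 1 ->
  16 / 15 <= n%:R / (D * eps) ->
  (10 ^ 6)%:R / eps * (n%:R / D ^+ 2 * (ln (n%:R / (D * eps))) ^+ 2 + ln (1 / delta))
    <= m%:R ->
  exists2 T : nat, 12 * n%:R < (3 * D / 8) ^+ 2 * T%:R &
    ((4 * m).+1 ^ T)%:R <= delta * (1 + eps) ^+ m.
Proof.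
move=> n1 /andP[D0 D1] /andP[e0 e1] /andP[d0 d1].
set L := n%:R / (D * eps) => L1; set l := ln L; set d := ln (1 / delta); set A := n%:R / D ^+ 2.
have n1R : 1 <= n%:R :> R by rewrite ler1n.
have De0 : 0 < D * eps by rewrite mulr_gt0.
have D20 : 0 < D ^+ 2 by rewrite exprn_gt0.
have nE : n%:R = A * D ^+ 2 by rewrite /A divfK // gt_eqF.
have A1 : 1 <= A.
  rewrite /A ler_pdivlMr // mul1r; apply: le_trans n1R.
  by rewrite exprn_ile1 // ltW.
have L0 : 0 < L by apply: lt_le_trans L1; lra.
(* The threshold [16 / 15] serves to keep the logarithm away from zero. *)
have l1 : 1 / 16 <= l.
  apply: le_trans (ln_ge_1BV L0).
  have : L^-1 <= (16 / 15)^-1 by rewrite lef_pV2 ?posrE //; lra.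
  by rewrite invf_div; lra.
have dgt0 : 0 < d by rewrite /d ln_gt0 // ltr_pdivlMr // mul1r.
have deltaE : delta = expR (- d).
  by rewrite expRN /d lnK ?posrE ?divr_gt0 // div1r invrK.
move=> hm.
have {}hm : 1000 * (1000 * (A * l ^+ 2 + d)) <= m%:R * eps.
  move: hm; rewrite natrX (_ : 10 ^+ 6 = 1000 * 1000) 1?mulrAC; last by ring.
  by rewrite ler_pdivrMr // -[1000 * 1000 * _]mulrA.
have l2 : 0 <= l ^+ 2 := sqr_ge0 l.
have m1 : 1 <= m%:R :> R.
  rewrite ler1n lt0n; apply/eqP => m0; move: hm; rewrite m0 mul0r.
  have : 0 <= A * l ^+ 2 by rewrite mulr_ge0 //; lra.
  by lra.
(* The constant comes from [12 * 64 / 9 < 86]. *)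
pose T := (Num.truncn (86 * A)).+1.
have A0 : 0 <= 86 * A by lra.
have /andP[T1 T2] := truncn_itv A0.
have T3 : T%:R <= 87 * A by rewrite /T -natr1; lra.
exists T.
  have h : D ^+ 2 * (86 * A) < D ^+ 2 * T%:R by rewrite ltr_pM2l.
  have -> : (3 * D / 8) ^+ 2 * T%:R = 9 / 64 * (D ^+ 2 * T%:R) by field.
  rewrite nE; have : 0 < A * D ^+ 2 by rewrite mulr_gt0 //; lra.
  by move: h; rewrite mulrCA [D ^+ 2 * A]mulrC; lra.
(* With this [k] the linear term costs [435 / 4096] of [m eps], well below the available half. *)
pose k : R := 64 * 64.
have k0 : 0 < k by rewrite mulr_gt0.
have kE : k = 2 ^+ 12 by rewrite /k; ring.
pose c := k * A / eps.
have c0 : 0 < c by rewrite !mulr_gt0 ?invr_gt0 //; lra.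
have cL : c <= expR (12 + 2 * l).
  rewrite expRD -[2]/(2%:R) expRM_natl lnK ?posrE //.
  have h12 := natrX2_le_expR R 12; rewrite -kE in h12.
  apply: (le_trans _ (ler_wpM2r (sqr_ge0 L) h12)).
  rewrite /c -mulrA ler_pM2l //.
  have -> : A / eps = n%:R / (D ^+ 2 * eps) by rewrite /A; field; rewrite !gt_eqF.
  have -> : L ^+ 2 = n%:R ^+ 2 / eps / (D ^+ 2 * eps).
    by rewrite /L; field; rewrite !gt_eqF.
  rewrite ler_pM2r ?invr_gt0 ?mulr_gt0 // ler_pdivlMr //.
  apply: (@le_trans _ _ (n%:R * 1)); first by rewrite ler_wpM2l // ltW.
  by rewrite expr2 ler_wpM2l.
have hM : ((4 * m).+1)%:R <= expR (12 + 2 * l + 5 * m%:R / c).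
  rewrite expRD; apply: (@le_trans _ _ (c * expR (5 * m%:R / c))); last first.
    by rewrite ler_wpM2r ?expR_ge0.
  have := expR_ge1Dx (5 * m%:R / c); rewrite -(ler_pM2l c0) mulrDr mulrCA divff ?gt_eqF //.
  by move=> h; apply: le_trans h; rewrite -natr1 natrM; lra.
rewrite natrX; apply: (@le_trans _ _ (expR (12 + 2 * l + 5 * m%:R / c) ^+ T)).
  by rewrite lerXn2r ?nnegrE ?expR_ge0.
apply: (@le_trans _ _ (delta * expR (eps / 2) ^+ m)); last first.
  rewrite ler_pM2l // lerXn2r ?nnegrE ?expR_ge0 //; first lra.
  by apply: expR_half_le; lra.
rewrite deltaE -!expRM_natl -expRD ler_expR.
have pos : 0 <= 12 + 2 * l + 5 * m%:R / c.
  have : 0 <= 5 * m%:R / c by rewrite divr_ge0 ?(ltW c0) // mulr_ge0.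
  by lra.
apply: (le_trans (ler_wpM2r pos T3)).
have -> : 87 * A * (12 + 2 * l + 5 * m%:R / c) =
    87 * (A * (12 + 2 * l)) + 435 * (m%:R * eps / k).
  by rewrite /c; field; rewrite !gt_eqF //; lra.
have hk : m%:R * eps / k * k = m%:R * eps by rewrite divfK // gt_eqF.
(* As [l >= 1 / 16], one has [12 <= 3072 l^2] and [2 l <= 32 l^2]. *)
have hA : A * (12 + 2 * l) <= A * (194 * (16 * l ^+ 2)).
  by rewrite ler_wpM2l //; [lra | rewrite expr2; nra].
have hl : 0 <= A * l ^+ 2 by rewrite mulr_ge0 //; lra.
have hme : 0 <= m%:R * eps / k.
  by rewrite divr_ge0 ?(ltW k0) // mulr_ge0 // ltW.
have {}hA : A * (12 + 2 * l) <= 194 * (16 * (A * l ^+ 2)).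
  by apply: (le_trans hA); rewrite [leRHS](_ : _ = A * (194 * (16 * l ^+ 2))) //; ring.
move: hm hk hA hl hme; rewrite /k.
move: (A * l ^+ 2) (A * (12 + 2 * l)) (m%:R * eps / (64 * 64)) => u v w.
have -> : m%:R * (eps / 2) = m%:R * eps / 2 by ring.
move: (m%:R * eps) => z; clear -dgt0; lra.
Qed.

End SampleSize.

(** * Discretization of the effects *)

Lemma measurement_effect (R : realType) (n : nat) (E : 'M[R[i]]_(2 ^ n)) :
  measurement E -> effect E.
Proof.
move=> [hE E01]; split => // i; have := E01 _ (eigenvalue_eigval i hE).
by rewrite -[1]/((1 : R)%:C)%C ler0c lecR.
Qed.

(** Each coordinate is rounded down on a grid of step [h]. Boundedness makes the alphabet finite,
    and a cell is a finite intersection of preimages of intervals. *)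
Lemma measurable_grid (R : realType) (dT : measure_display) (T : measurableType dT)
    (K : finType) (u : K -> T -> R) (B h : R) :
  (forall k, measurable_fun setT (u k)) -> (forall k t, `|u k t| <= B) -> 0 < h ->
  exists (J : finType) (r : T -> J), (forall j, measurable (r @^-1` [set j])) /\
    forall t t', r t = r t' -> forall k, `|u k t - u k t'| <= h.
Proof.
move=> mu uB h0.
pose v k t := (u k t + B) / h.
have v0 k t : 0 <= v k t.
  by rewrite /v divr_ge0 ?(ltW h0) //; have := uB k t; rewrite ler_norml => /andP[]; lra.
pose q := Num.truncn (2 * B / h).
have vq k t : (Num.truncn (v k t) < q.+1)%N.
  rewrite ltnS; apply: le_truncn; rewrite /v ler_pM2r ?invr_gt0 //.
  by have := uB k t; rewrite ler_norml => /andP[]; lra.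
pose r t : {ffun K -> 'I_q.+1} := [ffun k => Ordinal (vq k t)].
exists {ffun K -> 'I_q.+1}, r; split.
  move=> j.
  have -> : r @^-1` [set j] = \bigcap_(k in [set: K])
      ((v k) @^-1` `[(j k)%:R, (j k).+1%:R[).
    apply/seteqP; split=> [t /= <- k _|t /= h1].
      rewrite /= in_itv /= ffunE /=.
      by have /andP[] := truncn_itv (v0 k t); move=> -> ->.
    apply/ffunP => k; rewrite ffunE; apply/val_inj => /=.
    have := h1 k I; rewrite /= in_itv /= => h2.
    by apply/eqP; rewrite truncn_eq.
  apply: fin_bigcap_measurable => [|k _]; first exact: finite_finset.
  rewrite -[X in measurable X]setTI.
  have : measurable_fun setT (v k) by apply: measurable_funM => //; exact: measurable_funD.
  by apply => //; exact: measurable_itv.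
move=> t t' /ffunP rr k; have := rr k; rewrite !ffunE => -[e].
have /andP[a1 a2] := truncn_itv (v0 k t); have /andP[b1 b2] := truncn_itv (v0 k t').
rewrite e in a1 a2.
have -> : u k t - u k t' = (v k t - v k t') * h by rewrite /v; field; rewrite gt_eqF.
rewrite normrM (gtr0_norm h0) ler_piMl ?(ltW h0) //.
move: a2 b2; rewrite -natr1 ler_norml; lra.
Qed.

(** * Effects and states in dimension two *)

Section DimensionTwo.
Context {R : realType} {N : nat}.
Hypothesis N2 : N = 2%N.
Local Notation C := R[i].
Implicit Types A B E S : 'M[C]_N.

Lemma rtrDl A B D : rtr (A + B) D = rtr A D + rtr B D.
Proof. by rewrite rtrC rtrDr ![rtr D _]rtrC. Qed.

Lemma rtrNl A D : rtr (- A) D = - rtr A D.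
Proof. by rewrite rtrC rtrNr rtrC. Qed.

Lemma rtrZl (c : R) A D : rtr ((c%:C)%C *: A) D = c * rtr A D.
Proof. by rewrite rtrC rtrZr rtrC. Qed.

Lemma rtr_sqr_ge0 A : Defs.hermitian A -> 0 <= rtr A A.
Proof. by move=> hA; rewrite rtr_sqr //; apply: sumr_ge0 => i _; exact: sqr_ge0. Qed.

Lemma rtr11 : rtr (1%:M : 'M[C]_N) 1%:M = N%:R.
Proof.
rewrite /rtr mulmx1 mxtrace1.
by rewrite -(rmorph_nat (real_complex R)).
Qed.

Lemma rtr1_state S : state S -> rtr 1%:M S = 1.
Proof. by move=> [_ tS]; rewrite /rtr mul1mx tS. Qed.

(** As [H] is traceless, [E] may be replaced by [X = E - 1/2], of squared norm at most [2 / 4];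
    Cauchy-Schwarz concludes, in the form [\tr (H - 2 x X)^2 >= 0]. *)
Lemma rtr_effect_sqr_le E H : effect E -> Defs.hermitian H -> rtr 1%:M H = 0 ->
  2 * rtr E H ^+ 2 <= rtr H H.
Proof.
move=> [hE E01] hH H0; set x := rtr E H.
pose X := E - ((2^-1 : R)%:C)%C *: 1%:M.
have XE : X = fcalc (fun y => y - 2^-1) E.
  rewrite -fcalcD fcalc_id // fcalc_cst /X scalemx1.
  by rewrite rmorphN raddfN.
have XX : rtr X X <= 2^-1.
  rewrite {1 2}XE /rtr fcalcM tr_fcalc /=.
  apply: (@le_trans _ _ (\sum_(i < N) 4^-1)); last first.
    by rewrite big_const_ord iter_addr_0 N2 mulr2n; lra.
  by apply: ler_sum => i _; have /andP[] := E01 i; nra.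
have XH : rtr X H = x by rewrite /X rtrDl rtrNl rtrZl H0 mulr0 subr0.
have hX : Defs.hermitian X.
  by apply: hermitianD => //; apply: hermitianN; rewrite scalemx1; exact: hermitian_scalar.
have hZ : Defs.hermitian (H - ((2 * x)%:C)%C *: X).
  by apply: hermitianD => //; apply: hermitianN; exact: hermitianZ.
have := rtr_sqr_ge0 hZ.
rewrite rtrDl rtrNl rtrZl !rtrDr !rtrNr !rtrZr [rtr H X]rtrC XH.
have : 0 <= x ^+ 2 by exact: sqr_ge0.
move: (rtr X X) XX (rtr H H) => u; rewrite !expr2.
by move=> uu v x2 h; have := ler_wpM2r x2 uu; lra.
Qed.

(** By the parallelogram law the left side is at most [2 - \tr (S - rho)^2], and this trace is at
    least [2 (15/16)^2]. *)
Lemma far_states_complementary E S rho : effect E -> state S -> state rho ->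
  15 / 16 <= `|rtr E S - rtr E rho| ->
  rtr (S + rho - 1%:M) (S + rho - 1%:M) <= 4^-1.
Proof.
move=> eE stS str far.
have [hS _ _] := state_eigval stS; have [hr _ _] := state_eigval str.
have hD : Defs.hermitian (S - rho) by apply: hermitianD => //; exact: hermitianN.
have D0 : rtr 1%:M (S - rho) = 0 by rewrite rtrBr !rtr1_state // subrr.
have := rtr_effect_sqr_le eE hD D0; rewrite rtrBr.
have {}far : (15 / 16) ^+ 2 <= (rtr E S - rtr E rho) ^+ 2.
  by rewrite -[leRHS]real_normK ?num_real // lerXn2r // nnegrE //; lra.
have := state_sqr_le1 stS; have := state_sqr_le1 str; rewrite -!rtr_sqr //.
rewrite !(rtrDl, rtrNl, rtrDr, rtrNr) rtr11 (_ : N%:R = 2); last by rewrite N2.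
rewrite !rtr1_state // [rtr S 1%:M]rtrC [rtr rho 1%:M]rtrC !rtr1_state // [rtr rho S]rtrC.
move: far; rewrite [(15 / 16) ^+ 2]expr2.
move: ((_ - _) ^+ 2) (rtr S S) (rtr S rho) (rtr rho rho) => a b c d.
by lra.
Qed.

(** [S - S'] is the difference of two matrices of squared norm at most [1 / 4], so its own is at
    most [1], and [1 / 2 < (15/16)^2]. *)
Lemma far_states_close E E' F S S' rho : effect E -> effect E' -> effect F ->
  state S -> state S' -> state rho ->
  15 / 16 <= `|rtr E S - rtr E rho| -> 15 / 16 <= `|rtr E' S' - rtr E' rho| ->
  `|rtr F S - rtr F S'| < 15 / 16.
Proof.
move=> eE eE' eF stS stS' str far far'.
have [hS _ _] := state_eigval stS; have [hS' _ _] := state_eigval stS'.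
have [hr _ _] := state_eigval str.
have h1 := far_states_complementary eE stS str far.
have h2 := far_states_complementary eE' stS' str far'.
set Y := S + rho - 1%:M in h1; set Y' := S' + rho - 1%:M in h2.
have hI : Defs.hermitian (- 1%:M : 'M[C]_N) by apply: hermitianN; exact: (hermitian_scalar 1).
have hY : Defs.hermitian Y by apply: hermitianD => //; exact: hermitianD.
have hY' : Defs.hermitian Y' by apply: hermitianD => //; exact: hermitianD.
have SE : S - S' = Y - Y' by rewrite /Y /Y' opprD addrACA subrr addr0 opprD addrACA subrr addr0.
have hD : Defs.hermitian (S - S') by apply: hermitianD => //; exact: hermitianN.
have D0 : rtr 1%:M (S - S') = 0 by rewrite rtrBr !rtr1_state // subrr.
have h3 := rtr_effect_sqr_le eF hD D0; clearbody Y Y'.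
have h4 := rtr_sqr_ge0 (hermitianD hY hY').
have h5 : rtr (S - S') (S - S') = rtr Y Y - 2 * rtr Y Y' + rtr Y' Y'.
  by rewrite SE !(rtrDl, rtrNl, rtrDr, rtrNr) [rtr Y' Y]rtrC; ring.
have h6 : rtr (Y + Y') (Y + Y') = rtr Y Y + 2 * rtr Y Y' + rtr Y' Y'.
  by rewrite !(rtrDl, rtrDr) [rtr Y' Y]rtrC; ring.
rewrite h5 in h3; rewrite h6 in h4; rewrite -rtrBr.
have h7 : rtr F (S - S') ^+ 2 <= 2^-1.
  move: h1 h2 h3 h4; move: (rtr Y Y) (rtr Y Y') (rtr Y' Y') (_ ^+ 2) => a b c d.
  by clear; lra.
rewrite ltNge; apply/negP => h8.
have : (15 / 16) ^+ 2 <= `|rtr F (S - S')| ^+ 2.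
  by apply: lerXn2r; rewrite ?nnegrE //; clear; lra.
rewrite real_normK ?num_real //; move: h7; move: (_ ^+ 2) => d; rewrite expr2.
by clear; lra.
Qed.

End DimensionTwo.

(** * The learnability theorem *)

Lemma fsume_finType (R : realType) (J : finType) (A : pred J) (F : J -> \bar R) :
  (\sum_(j \in [set j | A j]) F j = \sum_(j | A j) F j)%E.
Proof.
rewrite (_ : [set j | A j] = [set` A]); last by apply/seteqP; split.
apply/esym/bigfs; first exact: index_enum_uniq.
by move=> i _; rewrite mem_index_enum.
Qed.

Section Learnability.
Context {R : realType} {n : nat}.
Local Notation C := R[i].
Variable rho : 'M[C]_(2 ^ n).
Hypothesis state_rho : mixed_state rho.
Context {dT : measure_display} {T : measurableType dT}.
Variables (D : probability T R) (Emap : T -> 'M[C]_(2 ^ n)).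
Hypothesis Emap_measurement : forall t, measurement (Emap t).
Hypothesis measurable_Re :
  forall j k, measurable_fun setT (fun t => complex.Re (Emap t j k)).
Hypothesis measurable_Im :
  forall j k, measurable_fun setT (fun t => complex.Im (Emap t j k)).

Local Notation acc t S := (rtr (Emap t) S).

Let Emap_effect t : effect (Emap t).
Proof. exact/measurement_effect. Qed.

Lemma measurable_acc S : measurable_fun setT (fun t => acc t S).
Proof.
under eq_fun do rewrite rtr_entries.
apply: measurable_sum => k; apply: measurable_sum => l.
by apply: measurable_funB; apply: measurable_funM => //; exact: measurable_cst.
Qed.

Definition far_set (gamma : R) S := [set t | gamma < `|acc t S - acc t rho|].

Lemma measurable_far_set gamma S : measurable (far_set gamma S).
Proof.
have mf : measurable_fun setT (fun t => `|acc t S - acc t rho|).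
  apply: measurableT_comp => //.
  by apply: measurable_funB; exact: measurable_acc.
have := mf measurableT _ (measurable_itv `]gamma, +oo[%R).
by rewrite setTI preimage_itvoy.
Qed.

Lemma far_set_ge1 gamma S : 1 <= gamma -> state S -> far_set gamma S = set0.
Proof.
move=> g1 stS; rewrite -subset0 => t; rewrite /far_set /=.
have /andP[a0 a1] := rtr_effect_state (Emap_effect t) stS.
have /andP[b0 b1] := rtr_effect_state (Emap_effect t) state_rho.
by rewrite ltNge => /negP; apply; rewrite ler_norml; apply/andP; split; lra.
Qed.

Section Sample.
Variables (m : nat) (eps eta gamma : R).

Lemma good_rtr (ts : 'I_m -> T) :
  (forall S, state S -> (forall i, `|acc (ts i) S - acc (ts i) rho| <= eta) ->
    (D (far_set gamma S) <= eps%:E)%E) ->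
  good D Emap rho eps eta gamma (fun i => Emap (ts i)).
Proof.
have accE t S : state S -> accept (Emap t) S = ((acc t S)%:C)%C.
  move=> stS; have [hS _ _] := state_eigval stS.
  by rewrite /accept rtr_hermitian //; case: (Emap_effect t).
have normE t S : state S -> `|accept (Emap t) S - accept (Emap t) rho| =
    ((`|acc t S - acc t rho|)%:C)%C.
  move=> stS; rewrite !accE // -rmorphB normc_def /=.
  by rewrite expr0n /= addr0 sqrtr_sqr.
move=> h S stS hS.
have -> : [set t | gamma%:C%C < `|accept (Emap t) S - accept (Emap t) rho|] = far_set gamma S.
  by apply/seteqP; split=> t; rewrite /far_set /= normE // ltcR.
by apply: h => // i; have := hS i; rewrite normE // lecR.
Qed.

Context {d : measure_display} {Omega : measurableType d} {P : probability Omega R}.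
Variable X : 'I_m -> Omega -> T.
Hypothesis iidX : iid_with_law P D X.

Lemma measurable_rect (A : 'I_m -> set T) : (forall i, measurable (A i)) ->
  measurable (\bigcap_(i in [set: 'I_m]) (X i @^-1` A i)).
Proof.
move=> mA; apply: fin_bigcap_measurable => [|i _]; first exact: finite_finset.
by rewrite -[X in measurable X]setTI; exact: (iidX.1 i).
Qed.

(* For such parameters [n = 1], and the lower bound on [m] is then too weak for a
   union bound. But all states that are far from [rho] on some effect are close
   to the antipode of [rho] in the Bloch ball, hence to each other, so that one
   sample point on which a fixed far state is detected excludes all of them. *)
Lemma good_extreme delta : n = 1%N -> 15 / 16 <= gamma - eta -> 0 < eta ->
  15 / 16 <= eps -> expR (- m%:R) <= delta ->
  exists G : set Omega, measurable G /\
    G `<=` [set w | good D Emap rho eps eta gamma (fun i => Emap (X i w))] /\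
    ((1 - delta)%:E <= P G)%E.
Proof.
move=> n1.
have N2 : (2 ^ n = 2)%N by rewrite n1.
have close := @far_states_close R _ N2; move=> {n1 N2} ge eta0 eps1 hdelta.
have [[S [stS badS]]|nobad] := pselect (exists S, state S /\ (eps%:E < D (far_set gamma S))%E);
  last first.
  exists setT; split; first exact: measurableT.
  split=> [w _|]; last first.
    by rewrite probability_setT lee_fin; have := expR_gt0 (- m%:R : R); lra.
  apply: good_rtr => S stS _; rewrite leNgt; apply/negP => h; apply: nobad; by exists S.
set B := far_set gamma S in badS.
have mB : measurable B by exact: measurable_far_set.
have mBC : measurable (~` B) by exact: measurableC.
have mR := measurable_rect (fun=> mBC).
exists (~` \bigcap_(i in [set: 'I_m]) (X i @^-1` (~` B))); split; first exact: measurableC.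
split.
  move=> w /= hw; apply: good_rtr => S' stS' hS'.
  have [i Bi] : exists i, B (X i w).
    by apply: contrapT => /forallNP h; apply: hw => i _; exact: h.
  rewrite leNgt; apply/negP => bad'.
  have [t Bt] : far_set gamma S' !=set0.
    apply/set0P/eqP => e; move: bad'; rewrite e measure0 lte_fin.
    by move=> h; lra.
  have g1 : 15 / 16 <= gamma by lra.
  have := close _ _ _ _ _ _ (Emap_effect (X i w)) (Emap_effect t)
    (Emap_effect (X i w)) stS stS' state_rho
    (le_trans g1 (ltW Bi)) (le_trans g1 (ltW Bt)).
  have := hS' i; move: Bi; rewrite /B /far_set /=.
  move: (acc (X i w) S) (acc (X i w) S') (acc (X i w) rho) => a b c h1 h2 h3.
  (* At this sample point [S] deviates from [rho] by more than [gamma] and [S'] by at most [eta], so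
     they differ by more than [15 / 16]. *)
  have := ler_normD (a - b) (b - c); rewrite addrA subrK.
  by lra.
rewrite probability_setC // EFinB leeB //.
rewrite (iidX.2 (fun=> ~` B)) // (eq_bigr (fun=> (1 - fine (D B))%:E)); last first.
  by move=> i _; rewrite probability_setC // EFinB fineK // fin_num_measure.
rewrite prodEFin lee_fin prodr_const card_ord.
have fB : eps < fine (D B) by rewrite -lte_fin fineK // fin_num_measure.
have fB1 : fine (D B) <= 1 by rewrite -lee_fin fineK ?fin_num_measure // probability_le1.
apply: le_trans hdelta; rewrite -mulrN1 expRM_natl lerXn2r ?nnegrE ?expR_ge0 //; first lra.
(* A point misses [B] with probability at most [1 / 16 <= (1 / 2)^2 <= exp (-1)]. *)
have h := expR_ge1Dx (- 2^-1 : R).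
have -> : -1 = -2^-1 + -2^-1 :> R by lra.
rewrite expRD; nra.
Qed.

(** [double_sample] is applied to the grid cells of the effects, each cell having a representative
    effect; [G] is the complement of a finite union of measurable events. *)
Lemma good_regular delta N : 0 <= eps -> 0 < gamma - eta <= 1 ->
  12 * n%:R < (3 * (gamma - eta) / 8) ^+ 2 * N%:R ->
  ((4 * m).+1 ^ N)%:R <= delta * (1 + eps) ^+ m ->
  exists G : set Omega, measurable G /\
    G `<=` [set w | good D Emap rho eps eta gamma (fun i => Emap (X i w))] /\
    ((1 - delta)%:E <= P G)%E.
Proof.
move=> eps0 /andP[g0 g1] hN hdelta.
(* Rounding costs [2 * beta] on the sample and again under [D]; with [a] below,
   [gamma = eta + 4 * beta + 2 * a]. *)
pose beta := (gamma - eta) / 16.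
have beta0 : 0 < beta by rewrite /beta; lra.
have N0 : 0 < (2 ^ n)%:R :> R by rewrite ltr0n expn_gt0.
(* This makes the bound of [rtr_state_le] equal to [beta]. *)
pose h : R := beta / (2 * (2 ^ n)%:R ^+ 2).
have h0 : 0 < h by rewrite divr_gt0 // mulr_gt0 // exprn_gt0.
pose u (k : 'I_(2 ^ n) * 'I_(2 ^ n) * bool) t :=
  if k.2 then complex.Re (Emap t k.1.1 k.1.2) else complex.Im (Emap t k.1.1 k.1.2).
have mu k : measurable_fun setT (u k) by rewrite /u; case: (k.2).
have uB k t : `|u k t| <= (2 ^ n)%:R.
  have [hE E01] := Emap_effect t.
  have s_le : \sum_i eigval (Emap t) i ^+ 2 <= (2 ^ n)%:R.
    rewrite -[X in _ <= X%:R]card_ord -sum1_card natr_sum; apply: ler_sum => i _.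
    by rewrite expr_le1 //; have /andP[] := E01 i.
  have norm_le (z : R) : z ^+ 2 <= (2 ^ n)%:R -> `|z| <= (2 ^ n)%:R.
    move=> hz; rewrite -(@ler_pXn2r _ 2) ?nnegrE // real_normK ?num_real //.
    by apply: (le_trans hz); rewrite -natrX ler_nat leq_pmulr // expn_gt0.
  have := le_trans (entry_sqr_le k.1.1 k.1.2 hE) s_le.
  rewrite /u => xy; case: ifP => _; apply: norm_le; apply: le_trans xy.
    by rewrite lerDl sqr_ge0.
  by rewrite lerDr sqr_ge0.
have [J [r [mr rP]]] := measurable_grid mu uB h0.
have [t0 _] : [set: T] !=set0.
  apply/set0P/eqP => e; have := probability_setT D; rewrite e measure0 => /eqP.
  by rewrite eqe eq_sym oner_eq0.
have /choice[rep repP] : forall j, exists t, (exists t', r t' = j) -> r t = j.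
  move=> j; have [[t' e]|ne] := pselect (exists t', r t' = j); first by exists t'.
  by exists t0 => /ne.
have repr t : r (rep (r t)) = r t by apply: repP; exists t.
have close t S : state S -> `|acc t S - acc (rep (r t)) S| <= beta.
  move=> stS; rewrite ![rtr _ S]rtrC -rtrBr rtrC.
  have -> : beta = 2 * (2 ^ n)%:R ^+ 2 * h.
    by rewrite /h mulrC divfK // gt_eqF // mulr_gt0 // exprn_gt0.
  apply: rtr_state_le => // k l.
  have e := rP _ _ (esym (repr t)).
  have e1 := e (k, l, true); have e2 := e (k, l, false).
  rewrite mxE [X in _ + X]mxE ReD ReN.
  split=> //; move: e2; rewrite /u /=.
  by case: (Emap t k l) => ? ?; case: (Emap (rep (r t)) k l).
pose p j := fine (D (r @^-1` [set j])).
have pE j : (p j)%:E = D (r @^-1` [set j]) by rewrite fineK // fin_num_measure.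
have p0 j : 0 <= p j by apply: fine_ge0; exact: measure_ge0.
have preimage_bigcup (A : pred J) : r @^-1` [set j | A j] =
    \bigcup_(j in [set j | A j]) r @^-1` [set j].
  apply/seteqP; split=> [t At|t [j Aj rt]]; first by exists (r t).
  by rewrite /= (_ : r t = j).
have mpreimage (A : pred J) : measurable (r @^-1` [set j | A j]).
  rewrite preimage_bigcup; apply: fin_bigcup_measurable => [|j _]; last exact: mr.
  exact: finite_finset.
have preimage_sum (A : pred J) : D (r @^-1` [set j | A j]) = (\sum_(j | A j) p j)%:E.
  rewrite -sumEFin; under eq_bigr do rewrite pE.
  have tr : trivIset [set j | A j] (fun j => r @^-1` [set j]).
    by move=> i j _ _ [t [/= <- <-]].
  rewrite preimage_bigcup (measure_fin_bigcup D finite_finset tr) //.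
  exact: fsume_finType.
have p1 : \sum_j p j = 1.
  have := preimage_sum predT; rewrite (_ : r @^-1` _ = setT) ?probability_setT.
    by move=> /eqP; rewrite eqe => /eqP <-.
  by apply/seteqP; split.
pose a := 3 * (gamma - eta) / 8.
pose f (S : {S : 'M[C]_(2 ^ n) | state S}) j := rtr (Emap (rep j)) (projT1 S).
pose f0 j := rtr (Emap (rep j)) rho.
pose bad (x : {ffun 'I_m -> J}) : bool := `[< exists S : {S | state S},
  (forall i, `|f S (x i) - f0 (x i)| <= eta + 2 * beta) /\
  eps < \sum_(j | far f f0 (eta + 2 * beta) a S j) p j >].
have covering (z : 'I_m * bool -> J) :
    exists G : N.-tuple (option ('I_m * bool * bool)) -> 'I_m * bool -> R,
    forall S, exists t, forall i, `|G t i - f S (z i)| <= a.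
  have a01 : 0 < a <= 1 by rewrite /a; apply/andP; split; lra.
  have [G GP] := @effect_cover R n N _ a (fun i => Emap (rep (z i)))
    (fun i => Emap_effect _) a01 hN.
  by exists G => -[S stS]; exact: GP.
have badP x : bad x -> exists S, (forall i, `|f S (x i) - f0 (x i)| <= eta + 2 * beta) /\
    eps < \sum_(j | far f f0 (eta + 2 * beta) a S j) p j by move/asboolP.
have := double_sample p0 p1 eps0 covering badP.
have -> : #|{: N.-tuple (option ('I_m * bool * bool))}| = ((4 * m).+1 ^ N)%N.
  by rewrite card_tuple card_option !card_prod card_bool card_ord -mulnA mulnC.
move=> /le_trans/(_ hdelta); rewrite ler_pM2r; last first.
  by rewrite exprn_gt0 //; lra.
move=> weight_bad.
pose cell (x : {ffun 'I_m -> J}) :=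
  \bigcap_(i in [set: 'I_m]) (X i @^-1` (r @^-1` [set x i])).
have mcell x : measurable (cell x) by apply: measurable_rect => i; exact: mr.
have Pcell x : P (cell x) = (weight p x)%:E.
  rewrite /cell (iidX.2 (fun i => r @^-1` [set x i])) // /weight -prodEFin.
  by apply: eq_bigr => i _; rewrite pE.
have mbad : measurable (\bigcup_(x in [set x | bad x]) cell x).
  by apply: fin_bigcup_measurable => [|x _ //]; exact: finite_finset.
exists (~` \bigcup_(x in [set x | bad x]) cell x); split; first exact: measurableC.
split; last first.
  rewrite probability_setC // EFinB leeB //.
  apply: (@le_trans _ _ (\sum_(x | bad x) (weight p x))%:E); last by rewrite lee_fin.
  rewrite -sumEFin; under eq_bigr do rewrite -Pcell.
  have := content_sub_fsum P (@finite_finset _ [set x | bad x])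
    (fun x _ => mcell x) mbad (fun _ => id).
  by rewrite fsume_finType.
move=> w hw; apply: good_rtr => S stS hS.
rewrite leNgt; apply/negP => badS; apply: hw.
exists [ffun i => r (X i w)]; last by move=> i _ /=; rewrite ffunE.
have closeS t := close t S stS; have closer t := close t rho state_rho.
apply/asboolP; exists (exist _ S stS); split.
  move=> i; rewrite ffunE /f /f0 /=.
  exact: ler_dist_perturb (hS i) (closeS _) (closer _).
rewrite -lte_fin -preimage_sum; apply: (lt_le_trans badS).
apply: le_measure; rewrite ?inE.
- exact: measurable_far_set.
- exact: mpreimage.
(* By contraposition: if the representative is not far, returning to [t] adds at most [2 * beta] to
   the deviation, which stays at most [gamma]. *)
- move=> t; rewrite /far_set /far /f /f0 /=; apply: contraPT; rewrite -leNgt => h1.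
  apply/negP; rewrite -leNgt.
  have -> : gamma = eta + 2 * beta + 2 * a + 2 * beta by rewrite /a /beta; field.
  by apply: ler_dist_perturb h1 _ _; rewrite distrC.
Qed.

End Sample.
End Learnability.

(** Goodness quantifies over uncountably many states, so its probability is bounded from inside by a
    measurable event [G]. *)
Theorem theorem2 :
  exists K : nat, (0 < K)%N /\
  forall (R : realType) (n : nat) (rho : 'M[R[i]]_(2 ^ n))
    (dT : measure_display) (T : measurableType dT) (D : probability T R)
    (Emap : T -> 'M[R[i]]_(2 ^ n))
    (d : measure_display) (Omega : measurableType d) (P : probability Omega R)
    (m : nat) (X : 'I_m -> Omega -> T)
    (eps eta gamma delta : R),
  (1 <= n)%N ->
  mixed_state rho ->
  (forall t, measurement (Emap t)) ->
  (forall j k, measurable_fun setT (fun t => complex.Re (Emap t j k))) ->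
  (forall j k, measurable_fun setT (fun t => complex.Im (Emap t j k))) ->
  iid_with_law P D X ->
  0 < eps -> 0 < eta -> eta < gamma -> 0 < delta < 1 ->
  m%:R >= K%:R / eps *
     (n%:R / (gamma - eta) ^+ 2 * (ln (n%:R / ((gamma - eta) * eps))) ^+ 2
      + ln (1 / delta)) ->
  exists G : set Omega, measurable G /\
    G `<=` [set w | good D Emap rho eps eta gamma (fun i => Emap (X i w))] /\
    ((1 - delta)%:E <= P G)%E.
Proof.
exists (10 ^ 6)%N; split; first by rewrite expn_gt0.
move=> R n rho dT T D Emap d Omega P m X eps eta gamma delta n1 strho mE mRe mIm iid.
move=> eps0 eta0 eg d01 hm; have /andP[d0 d1] := d01.
have triv : (forall S, state S -> (D (far_set rho Emap gamma S) <= eps%:E)%E) ->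
  exists G : set Omega, measurable G /\
    G `<=` [set w | good D Emap rho eps eta gamma (fun i => Emap (X i w))] /\
    ((1 - delta)%:E <= P G)%E.
  move=> h; exists setT; split; first exact: measurableT.
  split; first by move=> w _; apply: good_rtr => // S stS _; exact: h.
  by rewrite probability_setT lee_fin; lra.
have [g1|g1] := lerP 1 (gamma - eta).
  apply: triv => S stS; rewrite far_set_ge1 ?measure0 ?lee_fin ?(ltW eps0) //; lra.
have [e1|e1] := lerP 1 eps.
  apply: triv => S stS; apply: (@le_trans _ _ 1%E); last by rewrite lee_fin.
  by apply: probability_le1; exact: measurable_far_set.
have De0 : 0 < (gamma - eta) * eps by rewrite mulr_gt0 // subr_gt0.
(* Near ratio [1] the squared logarithm is too small for [sample_size_bound]. Ratios below [16 / 15]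
   force [n = 1] and put both [gamma - eta] and [eps] above [15 / 16]. *)
have [L1|L1] := lerP (16 / 15) (n%:R / ((gamma - eta) * eps)).
  have D01 : 0 < gamma - eta < 1 by rewrite subr_gt0 eg.
  have e01 : 0 < eps < 1 by rewrite eps0.
  have [N hN hd] := sample_size_bound n1 D01 e01 d01 L1 hm.
  by apply: (good_regular strho mE mRe mIm iid (ltW eps0) _ hN hd); rewrite subr_gt0 eg ltW.
have De1 : (gamma - eta) * eps <= 1.
  by rewrite mulr_ile1 ?subr_ge0 // ltW.
move: L1; rewrite ltr_pdivrMr // => L1.
have n_eq1 : n = 1%N.
  apply/eqP; rewrite eqn_leq n1 andbT leqNgt; apply/negP => n2.
  have : 2 <= n%:R :> R by rewrite ler_nat.
  by move: L1 De1; move: (_ * eps) (n%:R) => x y; clear; lra.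
apply: (good_extreme strho mE mRe mIm iid n_eq1) => //.
- move: L1; rewrite n_eq1; have : 0 < gamma - eta by rewrite subr_gt0.
  by move: (gamma - eta) {De0 De1 triv hm} g1 => x; nra.
- move: L1; rewrite n_eq1; have : 0 < gamma - eta by rewrite subr_gt0.
  by move: (gamma - eta) {De0 De1 triv hm} g1 => x; nra.
(* Since [K / eps >= 1], the confidence term alone gives [ln (1 / delta) <= m]. *)
- have lnd : 0 < ln (1 / delta) by rewrite ln_gt0 // ltr_pdivlMr // mul1r.
  have -> : delta = expR (- ln (1 / delta)).
    by rewrite expRN lnK ?posrE ?divr_gt0 // div1r invrK.
  rewrite ler_expR lerN2; apply: le_trans hm.
  have K1 : 1 <= (10 ^ 6)%:R / eps.
    rewrite ler_pdivlMr // mul1r; apply: (le_trans (ltW e1)).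
    by rewrite natrX exprn_ege1 // ler1n.
  rewrite -[leLHS]mul1r; apply: ler_pM => //; first exact: ltW.
  by rewrite lerDr mulr_ge0 ?sqr_ge0 // divr_ge0 // sqr_ge0.
Qed.
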